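(* Let $\mathsf{Prop}$ be the collection of all propositions, with equality $P=Q$ iff $P\iff Q$ and binary relation $P<Q$ iff $\neg P\wedge Q$. Then $(\mathsf{Prop},<)$ is a generalized ordered set.
   Context: The setting is constructive mathematics: no use of the law of excluded middle. For a set $X$ with a binary relation $<$, write $x\leq_{P}y$ if for all $z\in X$, $z<x$ implies $z<y$, and $y<z$ implies $x<z$. A generalized ordered set is a set $X$ with a binary relation $<$ such that for all $x,y,z\in X$: (asymmetry) $x<y$ implies $\neg(y<x)$; (transitivity) $x<y$ and $y<z$ imply $x<z$; (positive antisymmetry) $x\leq_{P}y$ and $y\leq_{P}x$ imply $x=y$. *)

(* Defs.v *)
From Stdlib Require Import RelationClasses Morphisms.

Definition leP {X : Type} (lt : X -> X -> Prop) (x y : X) : Prop :=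
  forall z : X, (lt z x -> lt z y) /\ (lt y z -> lt x z).

(* A set is a type [X] with its own equality [eqX], as in Bishop-style
   constructive mathematics; that [eqX] is an equivalence and that [lt] respects
   it is what it means for [lt] to be a binary relation on the set [(X, eqX)]. *)
Record is_generalized_ordered_set (X : Type) (eqX lt : X -> X -> Prop) : Prop := {
  gos_eq_equiv : Equivalence eqX;
  gos_lt_proper : Proper (eqX ==> eqX ==> iff) lt;
  gos_asym : forall x y : X, lt x y -> ~ lt y x;
  gos_trans : forall x y z : X, lt x y -> lt y z -> lt x z;
  gos_pos_antisym : forall x y : X, leP lt x y -> leP lt y x -> eqX x y
}.

Definition prop_eq (P Q : Prop) : Prop := P <-> Q.

Definition prop_lt (P Q : Prop) : Prop := ~ P /\ Q.

(* Main.v *)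
From Stdlib Require Import RelationClasses.
Require Import Defs.

(** The order axioms are intuitionistic tautologies. For positive antisymmetry, the propositions
    below [P] determine [P]: [False] lies below it exactly when [P] holds. So [leP] entails
    implication, and [leP] both ways gives [P <-> Q], which is equality here. *)

Lemma leP_prop_lt_impl (P Q : Prop) : leP prop_lt P Q -> P -> Q.
Proof.
  (* [False < R] is equivalent to [R], so testing at [z = False] suffices. *)
  intros H HP. destruct (H False) as [H0 _].
  exact (proj2 (H0 (conj (fun f => f) HP))).
Qed.

Theorem theorem9 : is_generalized_ordered_set Prop prop_eq prop_lt.
Proof.
  split.
  - exact iff_equivalence.
  - intros P P' HP Q Q' HQ. unfold prop_eq, prop_lt in *. tauto.
  - unfold prop_lt. tauto.
  (* Vacuous: a chain [x < y < z] would give both [y] and [~ y]. *)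
  - unfold prop_lt. tauto.
  - intros P Q HPQ HQP. split; now apply leP_prop_lt_impl.
Qed.
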